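(* Let $u\ge 0$ be a measurable function on $\mathbb R^n$ and let $v(x)=|x|^{-nr}$ for some $r>1$. Then there is a constant $C$ such that for all $t>0$ and every measurable function $f$ on $\mathbb R^n$, $$uv\bigg(\bigg\{x\in\mathbb R^n:\frac{M(fv)(x)}{v(x)}>t\bigg\}\bigg)\le\frac{C}{t}\int_{\mathbb R^n}|f(x)|\,Mu(x)\,v(x)\,dx.$$
   Context: $M$ is the Hardy–Littlewood maximal operator on $\mathbb R^n$. For a measurable set $E$, $uv(E)=\int_E u(x)v(x)\,dx$. *)

(* Defs.v *)
From HB Require Import structures.
From mathcomp Require Import all_boot all_order all_algebra.
From mathcomp Require Import all_classical all_reals all_analysis.

Set Implicit Arguments.
Unset Strict Implicit.
Unset Printing Implicit Defensive.

Import Order.TTheory GRing.Theory Num.Theory.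
Import numFieldNormedType.Exports.

Local Open Scope classical_set_scope.
Local Open Scope ring_scope.

(* R^n with its Borel sigma-algebra, the product of those of the factors *)
Notation borelRn R n := (n.-tuple (measurableTypeR R)).

Section borel_lebesgue_step.
Context {R : realType} {n : nat}.
Variable mu : {sigma_finite_measure set (borelRn R n) -> \bar R}.
Local Open Scope ereal_scope.

Definition consRn (z : measurableTypeR R * borelRn R n) : borelRn R n.+1 :=
  [tuple of z.1 :: z.2].

Lemma measurable_consRn : measurable_fun setT consRn.
Proof. exact: measurable_cons. Qed.

Definition cons_measure : set (borelRn R n.+1) -> \bar R :=
  pushforward (lebesgue_measure \x mu) consRn.

Let cons_measure0 : cons_measure set0 = 0.
Proof. by rewrite /cons_measure /pushforward preimage_set0 measure0. Qed.

Let cons_measure_ge0 A : 0 <= cons_measure A.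
Proof. exact: integral_ge0. Qed.

Let cons_measure_sigma_additive : semi_sigma_additive cons_measure.
Proof.
move=> F mF tF mUF; rewrite /cons_measure /pushforward preimage_bigcup.
apply: measure_semi_sigma_additive.
- by move=> k; rewrite -[X in measurable X]setTI; exact: measurable_consRn.
- apply/trivIsetP => /= i j _ _ ij; rewrite -preimage_setI.
  by move/trivIsetP : tF => /(_ _ _ _ _ ij) ->//; rewrite preimage_set0.
- rewrite -preimage_bigcup -[X in measurable X]setTI.
  exact: measurable_consRn.
Qed.

HB.instance Definition _ := isMeasure.Build _ _ _ cons_measure
  cons_measure0 cons_measure_ge0 cons_measure_sigma_additive.

Let cons_measure_sigma_finite : sigma_finite setT cons_measure.
Proof.
have /sigma_finiteP[F [TF ndF Foo]] := sigma_finiteT (@lebesgue_measure R).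
have /sigma_finiteP[G [TG ndG Goo]] := sigma_finiteT mu.
pose H k := [set x : borelRn R n.+1 |
  F k (thead x) /\ G k [tuple of behead x]].
have HE k : consRn @^-1` (H k) = F k `*` G k.
  suff zE x y : H k (consRn (x, y)) = (F k x /\ G k y).
    by apply/seteqP; split=> -[x y] /=; rewrite zE.
  by rewrite /H /= theadE; congr (_ /\ G k _); exact/val_inj.
exists H.
  apply/seteqP; split=> // x _.
  have [i _ Fi] : (\bigcup_i F i) (thead x) by rewrite -TF.
  have [j _ Gj] : (\bigcup_i G i) [tuple of behead x] by rewrite -TG.
  exists (maxn i j) => //; split.
  - by move: (thead x) Fi; exact/subsetPset/ndF/leq_maxl.
  - by move: [tuple of behead x] Gj; exact/subsetPset/ndG/leq_maxr.
move=> k; have [mF Fk] := Foo k; have [mG Gk] := Goo k; split.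
  apply: measurableI; rewrite -[X in measurable X]setTI.
  - exact: (@measurable_tnth _ _ _ ord0).
  - exact: measurable_behead.
rewrite /cons_measure /pushforward HE product_measure1E//.
by rewrite lte_mul_pinfty// ge0_fin_numE.
Qed.

HB.instance Definition _ := Measure_isSigmaFinite.Build _ _ _ cons_measure
  cons_measure_sigma_finite.

End borel_lebesgue_step.

Fixpoint borel_lebesgue {R : realType} (n : nat) :
    {sigma_finite_measure set (borelRn R n) -> \bar R} :=
  match n with
  | 0 => dirac ([tuple] : borelRn R 0)
  | m.+1 => cons_measure (@borel_lebesgue R m)
  end.

Lemma measurable_box (R : realType) (n : nat) (a b : 'I_n -> R) :
  measurable [set x : borelRn R n | forall i, tnth x i \in `[a i, b i]].
Proof.
rewrite (_ : mkset _ = \bigcap_(i in [set: 'I_n])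
  ((fun y : borelRn R n => tnth y i) @^-1` `[a i, b i])).
  apply: fin_bigcap_measurable => // i _; rewrite -[X in measurable X]setTI.
  exact: measurable_tnth.
by apply/seteqP; split=> y /=; [move=> h i _|move=> h i]; apply: h.
Qed.

Lemma borel_lebesgue_box (R : realType) (n : nat) (a b : 'I_n -> R) :
  (forall i, a i <= b i) ->
  borel_lebesgue n [set x : borelRn R n | forall i, tnth x i \in `[a i, b i]]
  = (\prod_(i < n) (b i - a i))%:E.
Proof.
elim: n a b => [|n IH] a b ab.
  by rewrite big_ord0 /= diracE mem_set//= => -[].
rewrite big_ord_recl /= /cons_measure /pushforward.
pose B := [set y : borelRn R n |
  forall i, tnth y i \in `[a (lift ord0 i), b (lift ord0 i)]].
rewrite (_ : _ @^-1` _ = `[a ord0, b ord0] `*` B); last first.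
  apply/seteqP; split=> -[x y] /=.
    move=> h; split; first by have := h ord0.
    by move=> i; have := h (lift ord0 i); rewrite tnthS.
  move=> [x0 yB] i; case: (unliftP ord0 i) => [j|] ->; last exact: x0.
  by rewrite tnthS; exact: yB.
rewrite product_measure1E//; last exact: measurable_box.
rewrite IH// EFinM; congr (_ * _)%E.
rewrite [LHS]lebesgue_measure_itv/= lte_fin.
by case: ltgtP (ab ord0) => // -> _; rewrite subrr.
Qed.

(* R^n with the sigma-algebra of Lebesgue measurable sets, i.e., the
   Caratheodory-measurable sets of the outer measure of [borel_lebesgue n] *)
Notation Rn R n := (caratheodory_type (mu_ext (@borel_lebesgue R n))).

Section Rn.
Context {R : realType} {n : nat}.
Implicit Types (x a : Rn R n) (l : R) (f : Rn R n -> R).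
Local Open Scope ereal_scope.

Definition lebesgueRn : set (Rn R n) -> \bar R :=
  @completed_measure_extension _ _ _ (@borel_lebesgue R n).

HB.instance Definition _ := Measure.on lebesgueRn.

Let lebesgueRn_sigma_finite : sigma_finite setT lebesgueRn.
Proof. exact/completed_measure_extension_sigma_finite/sigma_finiteT. Qed.

HB.instance Definition _ := Measure_isSigmaFinite.Build _ _ _ lebesgueRn
  lebesgueRn_sigma_finite.

Definition euclid_norm x : R := Num.sqrt (\sum_(i < n) tnth x i ^+ 2).

Definition cube a l : set (Rn R n) :=
  [set x | forall i, tnth x i \in `[tnth a i, tnth a i + l]%R].

Lemma lebesgueRn_cube a l : (0 < l)%R -> lebesgueRn (cube a l) = (l ^+ n)%:E.
Proof.
move=> l0; rewrite /lebesgueRn /completed_measure_extension measurable_mu_extE /=.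
  rewrite borel_lebesgue_box => [|i]; last by rewrite lerDl ltW.
  by under eq_bigr do rewrite addrAC subrr add0r; rewrite prodr_const card_ord.
exact: measurable_box.
Qed.

(* non-centred maximal operator, over the cubes with sides parallel to the axes *)
Definition maximal f x : \bar R :=
  ereal_sup [set (lebesgueRn Q)^-1 * \int[lebesgueRn]_(y in Q) `|(f y)%:E| |
    Q in [set Q | exists a l, [/\ (0 < l)%R, Q = cube a l & Q x]]].

(* the value at 0 is 0 instead of +oo, which is immaterial for a weight *)
Definition power_weight (r : R) x : R := euclid_norm x `^ (- (n%:R * r)).

End Rn.

(* Main.v *)
Require Import Defs.
From HB Require Import structures.
From mathcomp Require Import all_boot all_order all_algebra.
From mathcomp Require Import all_classical all_reals all_analysis.
From mathcomp Require Import measurable_realfun ring lra.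

Set Implicit Arguments.
Unset Strict Implicit.
Unset Printing Implicit Defensive.

Import Order.TTheory GRing.Theory Num.Theory.
Import numFieldNormedType.Exports.

Local Open Scope classical_set_scope.
Local Open Scope ring_scope.

(** Put N(x) = max_i |x_i| and p = n * r > n.  Since N is comparable with the
    Euclidean norm, v is comparable with w = N^(-p), and it suffices to bound
    the integral of u * w over the set where some average of g = |f| * v over
    a cube Q containing x exceeds a multiple of t * w(x).

    The arithmetic with maximal functions is done with [rat_maximal], the
    supremum over cubes with rational corner and side.  It is measurable
    because only countably many cubes occur, it is dominated by [maximal], and
    every cube sits in a rational one of at most twice its side, so that
    passing from arbitrary cubes to rational ones costs only a factor 2^n
    ([integral_cube_le], [maximal_gt_rat_cube]).

    Let l be the side of a rational cube Q containing x with
    t * w(x) * l^n < int_Q g, and let rho = N(x).  One of three things happens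
    ([near_inner_outer]).

    - Near: 4 * l <= rho.  Then w is comparable with w(x) on the cube 3Q, so
      uw(3Q) <= C * w(x) * u(3Q) <= (C / t) * int_Q g * (average of u on 3Q),
      and that average is at most Mu at each point of Q.  Vitali's covering
      argument adds up these local estimates ([weak_type_of_covering],
      [near_estimate]).

    - Inner: 4 * l > rho, and the part of g in the ball
      N <= rho carries half of the integral.  Then
      int_(N <= rho) g >= c * t * rho^(n - p).  Because p > n, a sum over dyadic
      shells converges and gives uw(N >= rho) <= C * rho^(n - p) * Mu(y)
      whenever N(y) <= 2 * rho ([tail_estimate]); the two facts combine
      ([inner_estimate]).  The exterior domains form a chain, hence the bound
      for each of them is a bound for their union.

    - Outer: 4 * l > rho, and the part of g in N > rho
      carries half of the integral.  There N(y) <= 5 * l, hence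
      int_(N(y) > rho) g(y) * N(y)^(-n) dy >= c * t * w(x).
      Chebyshev's inequality and Tonelli's theorem reduce the estimate to
      int_(N(x) < N(y)) u(x) dx <= (4 * N(y))^n * Mu(y) ([outer_estimate]).

    The level set and the function [maximal u] enter only through
    monotonicity of the integral, which holds without measurability
    ([ge0_le_integral_sub]). *)

(** * Monotonicity and countable unions *)

Section measure_tools.
Local Open Scope ereal_scope.
Context d (T : measurableType d) (R : realType).
Variable mu : {measure set T -> \bar R}.

(** The integral of a nonnegative function is a supremum over the simple
    functions below it, so monotonicity holds for arbitrary sets and functions.
    This is what allows non-measurable level sets and maximal functions. *)
Lemma ge0_le_integral_sub (D E : set T) (f g : T -> \bar R) :
  D `<=` E -> (forall x, D x -> 0 <= f x <= g x) ->
  (forall x, E x -> 0 <= g x) ->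
  \int[mu]_(x in D) f x <= \int[mu]_(x in E) g x.
Proof.
move=> DE fg g0; rewrite (integral_mkcond D) (integral_mkcond E).
have f0' x : 0 <= (f \_ D) x by apply: erestrict_ge0 => y /fg /andP[].
have g0' x : 0 <= (g \_ E) x by exact: erestrict_ge0.
rewrite !ge0_integralTE//; apply: ereal_sup_le => _ [h /= hf <-].
exists h => //= x; apply: (le_trans (hf x)).
rewrite !patchE; case: ifPn => [|_].
  by rewrite inE => Dx; rewrite mem_set; [have /andP[] := fg _ Dx|exact: DE].
by have := g0' x; rewrite patchE.
Qed.

(** Continuity from below along an enumeration of [I]. *)
Lemma integral_bigcup_le (I : countType) (P : set I) (E : I -> set T)
    (h : T -> \bar R) (K : \bar R) :
  (forall i, measurable (E i)) -> measurable_fun [set: T] h ->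
  (forall x, 0 <= h x) ->
  (forall s : seq I, {in s, forall i, P i} ->
     \int[mu]_(x in \bigcup_(i in [set` s]) E i) h x <= K) ->
  \int[mu]_(x in \bigcup_(i in P) E i) h x <= K.
Proof.
move=> mE mh h0 hK.
pose S m := if unpickle m is Some i then
  if `[< P i >] then E i else set0 else set0.
have mS m : measurable (S m).
  by rewrite /S; case: unpickle => // i; case: ifP.
have -> : \bigcup_(i in P) E i = \bigcup_m S m.
  apply/seteqP; split => [x [i Pi Ex]|x [m _]].
    by exists (pickle i) => //; rewrite /S pickleK; case: asboolP.
  by rewrite /S; case: unpickle => // i; case: asboolP => // Pi Ex; exists i.
rewrite -bigcup_bigsetU_bigcup.
apply: (cvge_to_le (@ge0_nondecreasing_set_cvg_integral _ _ _
  (fun N => \big[setU/set0]_(i < N.+1) S i) h mu _ _ _ _)) => //.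
- by move=> a b ab; apply/subsetPset/subset_bigsetU.
- by move=> i; exact: bigsetU_measurable.
- by move=> i; exact: measurable_funTS.
apply: nearW => N.
pose s := [seq i <- pmap unpickle (iota 0 N.+1) | `[< P i >]].
suff -> : \big[setU/set0]_(m < N.+1) S m = \bigcup_(i in [set` s]) E i.
  by apply: hK => i; rewrite mem_filter => /andP[/asboolP].
rewrite -bigcup_mkord; apply/seteqP; split => x [].
  move=> m /= mN; rewrite /S; case um: (@unpickle I m) => [i|]//.
  case: asboolP => // Pi Ex; exists i => //=.
  rewrite mem_filter asboolT// andTb mem_pmap -um; apply: map_f.
  by rewrite (mem_iota 0 N.+1) add0n.
move=> i /=; rewrite mem_filter mem_pmap.
move=> /andP[/asboolP Pi /mapP[m mN im]] Ex.
exists m; first by move: mN; rewrite (mem_iota 0 N.+1) add0n.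
by rewrite /S -im; case: asboolP.
Qed.

(** A nonempty finite union of members of a chain is one of its members. *)
Lemma integral_bigcup_chain_le (I : countType) (P : set I) (E : I -> set T)
    (h : T -> \bar R) (K : \bar R) :
  (forall i, measurable (E i)) -> measurable_fun [set: T] h ->
  (forall x, 0 <= h x) ->
  (forall i j, E i `<=` E j \/ E j `<=` E i) -> 0 <= K ->
  (forall i, P i -> \int[mu]_(x in E i) h x <= K) ->
  \int[mu]_(x in \bigcup_(i in P) E i) h x <= K.
Proof.
move=> mE mh h0 chainE K0 hK; apply: integral_bigcup_le => // s sP.
suff [->|[i si sub]] : \bigcup_(i in [set` s]) E i = set0 \/
    exists2 i, i \in s & \bigcup_(i in [set` s]) E i `<=` E i.
- by rewrite integral_set0.
- apply: le_trans (hK i (sP i si)).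
  by apply: ge0_le_integral_sub => // x _; rewrite h0 lexx.
elim: s {sP} => [|i s [se|[j sj sub]]].
- by left; apply/seteqP; split => // x [].
- right; exists i; first exact: mem_head.
  move=> x [k /= + Ex]; rewrite inE => /predU1P[<-//|sk].
  by have : (\bigcup_(i in [set` s]) E i) x; [exists k|rewrite se].
- have {}sub k : k \in s -> E k `<=` E j.
    by move=> sk x Ex; apply: sub; exists k.
  right; have [EiEj|EjEi] := chainE i j.
    exists j; first by rewrite inE sj orbT.
    move=> x [k /=]; rewrite inE => /predU1P[-> /EiEj //|sk Ex].
    exact: sub sk _ Ex.
  exists i; first exact: mem_head.
  move=> x [k /=]; rewrite inE => /predU1P[->//|sk Ex].
  exact/EjEi/(sub _ sk).
Qed.

End measure_tools.

(** * The covering argument *)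

Section covering.

(** The greedy selection: treat the sets in decreasing order of size [l] and
    keep a set when it misses all those kept before.  A rejected set meets a
    larger kept one, and therefore lies in its enlargement [Q']. *)
Lemma finite_Vitali (I : eqType) (T : Type) (R : realDomainType)
    (Q Q' : I -> set T) (l : I -> R) :
  (forall i j, l i <= l j -> Q i `&` Q j !=set0 -> Q i `<=` Q' j) ->
  forall s : seq I, exists D : seq I, [/\ uniq D, {subset D <= s},
    trivIset [set` D] Q &
    forall i, i \in s -> exists2 j, j \in D & Q i `<=` Q' j].
Proof.
move=> QQ'.
have sub_self i : Q i `<=` Q' i.
  by move=> x Qx; apply: (QQ' i i) => //; exists x.
suff sorted_case s : sorted (fun i j => l j <= l i) s -> exists D : seq I,
    [/\ uniq D, {subset D <= s}, trivIset [set` D] Q &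
    forall i, i \in s -> exists2 j, j \in D & Q i `<=` Q' j].
  move=> s.
  have [|D [uD Ds tD cD]] := sorted_case (sort (fun i j => l j <= l i) s).
    by apply: sort_sorted => i j; exact: le_total.
  exists D; split => //.
    by move=> i /Ds; rewrite mem_sort.
  by move=> i si; apply: cD; rewrite mem_sort.
elim/last_ind: s => [_|s i IH]; first by exists [::]; split.
move=> ss.
have tr : transitive (fun i j => l j <= l i).
  by move=> a b c ba cb; exact: le_trans cb ba.
have li j : j \in s -> l i <= l j.
  move=> js; have := sorted_pairwise tr (rcons s i).
  by rewrite ss pairwise_rcons => /esym/andP[/allP/(_ _ js)].
have [|D [uD Ds tD cD]] := IH.
  by move: ss; rewrite !sorted_pairwise// pairwise_rcons => /andP[].
have [[j jD QiQj]|disj] := pselect (exists2 j, j \in D & Q i `&` Q j !=set0).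
  exists D; split => //.
    by move=> k /Ds ks; rewrite mem_rcons inE ks orbT.
  move=> k; rewrite mem_rcons inE => /predU1P[->|]; last exact: cD.
  by exists j => //; apply: QQ' => //; apply/li/Ds.
have [iD|iD] := boolP (i \in D).
  exists D; split => //.
    by move=> k /Ds ks; rewrite mem_rcons inE ks orbT.
  move=> k; rewrite mem_rcons inE => /predU1P[->|]; last exact: cD.
  by exists i.
exists (i :: D); split => /=.
- by rewrite iD.
- move=> k; rewrite mem_rcons !inE.
  by move=> /predU1P[->|/Ds ->]; rewrite ?eqxx ?orbT.
- move=> a b /=; rewrite !inE => /predU1P[->|aD] /predU1P[->|bD] //.
  + by move=> ne; exfalso; apply: disj; exists b.
  + by rewrite setIC => ne; exfalso; apply: disj; exists a.
  + exact: tD.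
- move=> k; rewrite mem_rcons inE => /predU1P[->|/cD[j jD Qj]].
    by exists i; rewrite ?mem_head.
  by exists j; rewrite // inE jD orbT.
Qed.

Local Open Scope ereal_scope.

(** Finitely many of the sets [Q i] are covered by enlargements of disjoint
    ones; the local estimates for the latter add up because the [Q i] on the
    right-hand side are disjoint. *)
Lemma weak_type_of_covering d (T : measurableType d) (R : realType)
    (mu : {measure set T -> \bar R}) (I : countType)
    (Q Q' : I -> set T) (l : I -> R) (P : set I) (h k : T -> \bar R) :
  (forall i, measurable (Q i)) -> (forall i, measurable (Q' i)) ->
  measurable_fun [set: T] h -> (forall x, 0 <= h x) ->
  measurable_fun [set: T] k -> (forall x, 0 <= k x) ->
  (forall i j, (l i <= l j)%R -> Q i `&` Q j !=set0 -> Q i `<=` Q' j) ->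
  (forall i, P i -> \int[mu]_(x in Q' i) h x <= \int[mu]_(x in Q i) k x) ->
  \int[mu]_(x in \bigcup_(i in P) Q i) h x <= \int[mu]_x k x.
Proof.
move=> mQ mQ' mh h0 mk k0 QQ' hk.
apply: integral_bigcup_le => // s sP.
have [D [uD Ds tD cD]] := finite_Vitali QQ' s.
apply: (@le_trans _ _ (\int[mu]_x (\sum_(i <- D) (h \_ (Q' i)) x))).
  apply: ge0_le_integral_sub => // x.
    move=> [i /= si Qx]; have [j jD Qij] := cD i si.
    rewrite h0/= (big_rem j)//= patchE mem_set; last exact: Qij.
    by apply: leeDl; apply: sume_ge0 => a _; exact: erestrict_ge0.
  by move=> _; apply: sume_ge0 => a _; exact: erestrict_ge0.
have mR (A : set T) (g : T -> \bar R) :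
    measurable A -> measurable_fun [set: T] g -> measurable_fun setT (g \_ A).
  move=> mA mg; apply/(measurable_restrictT _ _).1 => //.
  exact: measurable_funTS.
rewrite ge0_integral_sum//=; last 2 first.
- by move=> i; exact: mR.
- by move=> i x _; exact: erestrict_ge0.
apply: (@le_trans _ _ (\sum_(i <- D) \int[mu]_(x in Q i) k x)).
  rewrite big_seq [leRHS]big_seq; apply: lee_sum => i iD.
  by rewrite -integral_mkcond; exact/hk/sP/Ds.
rewrite -ge0_integral_bigsetU//; last exact: measurable_funTS.
by apply: ge0_le_integral_sub => // x _; rewrite k0 lexx.
Qed.

End covering.

(** * Cubes and the sup norm *)

Section geometry.
Context {R : realType} {n : nat}.
Implicit Types (x y a : Rn R n) (l : R) (q : rat * n.-tuple rat).

Lemma borel_measurable_Rn (A : set (borelRn R n)) :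
  measurable A -> measurable (A : set (Rn R n)).
Proof.
by move=> mA; apply: (@sub_caratheodory _ _ _ (@borel_lebesgue R n));
  exact: sub_gen_smallest.
Qed.

Lemma measurable_coord (i : 'I_n) :
  measurable_fun [set: Rn R n] (fun x => tnth x i : R).
Proof.
move=> _ Y mY; apply: borel_measurable_Rn.
exact: (@measurable_tnth _ (measurableTypeR R) n i measurableT Y).
Qed.

Lemma measurable_cube a l : measurable (cube a l).
Proof. by apply: borel_measurable_Rn; exact: measurable_box. Qed.

Definition sup_norm x : R := \big[Order.max/0]_(i < n) `|tnth x i|.

Lemma sup_norm_ge0 x : 0 <= sup_norm x.
Proof. exact: bigmax_ge_id. Qed.

Lemma ler_sup_norm x i : `|tnth x i| <= sup_norm x.
Proof. exact: (le_bigmax 0 (fun i => `|tnth x i|)). Qed.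

Lemma sup_norm_le x (b : R) : 0 <= b -> (forall i, `|tnth x i| <= b) ->
  sup_norm x <= b.
Proof. by move=> b0 xb; apply/bigmax_leP; split. Qed.

Lemma measurable_sup_norm : measurable_fun [set: Rn R n] sup_norm.
Proof.
rewrite /sup_norm; elim: (index_enum _) => [|i s ih].
  by under eq_fun do rewrite big_nil; exact: measurable_cst.
rewrite (_ : (fun x => _) = fun x : Rn R n =>
    Order.max `|tnth x i| (\big[Order.max/0]_(j <- s) `|tnth x j|)).
  exact: (measurable_maxr
    (measurableT_comp (@normr_measurable R setT) (measurable_coord i)) ih).
by apply/funext => x; rewrite big_cons.
Qed.

Lemma sup_norm_le_euclid x : sup_norm x <= euclid_norm x.
Proof.
apply: sup_norm_le => [|i]; first exact: sqrtr_ge0.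
rewrite -sqrtr_sqr ler_wsqrtr// (bigD1 i)//= lerDl.
by apply: sumr_ge0 => j _; exact: sqr_ge0.
Qed.

Lemma euclid_le_sup_norm x : euclid_norm x <= n%:R * sup_norm x.
Proof.
have nN : 0 <= n%:R * sup_norm x by rewrite mulr_ge0// sup_norm_ge0.
rewrite -(ger0_norm nN) -sqrtr_sqr ler_wsqrtr//.
apply: (@le_trans _ _ (\sum_(i < n) sup_norm x ^+ 2)).
  apply: ler_sum => i _; rewrite -real_normK ?num_real//.
  by rewrite lerXn2r ?nnegrE ?sup_norm_ge0// ler_sup_norm.
rewrite sumr_const card_ord -[leLHS]mulr_natl exprMn ler_wpM2r ?sqr_ge0//.
by rewrite -natrX ler_nat; case: (n) => // m; rewrite leq_pmulr.
Qed.

Lemma cube_dist a l x y i : cube a l x -> cube a l y ->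
  `|tnth x i - tnth y i| <= l.
Proof.
move=> /(_ i); rewrite in_itv/= => /andP[? ?].
move=> /(_ i); rewrite in_itv/= => /andP[? ?].
by rewrite ler_norml; lra.
Qed.

Lemma sup_norm_dist x y l : 0 <= l -> (forall i, `|tnth x i - tnth y i| <= l) ->
  sup_norm x <= sup_norm y + l.
Proof.
move=> l0 xy; apply: sup_norm_le => [|i].
  by rewrite addr_ge0// sup_norm_ge0.
have := xy i; have := ler_sup_norm y i; rewrite !ler_norml; lra.
Qed.

Definition rat_point (c : n.-tuple rat) : Rn R n :=
  [tuple ratr (tnth c i) | i < n].

Definition rat_cube q : set (Rn R n) := cube (rat_point q.2) (ratr q.1).

(** Index of the cube with the same centre and three times the side, which is
    again rational. *)
Definition triple q : rat * n.-tuple rat :=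
  (q.1 * 3, [tuple tnth q.2 i - q.1 | i < n]).

Lemma rat_cubeP q x : rat_cube q x <->
  forall i, ratr (tnth q.2 i) <= tnth x i <= ratr (tnth q.2 i) + ratr q.1.
Proof.
by split=> + i => /(_ i); rewrite in_itv/= tnth_mktuple.
Qed.

Lemma rat_cube_tripleP q x : rat_cube (triple q) x <->
  forall i, ratr (tnth q.2 i) - ratr q.1 <= tnth x i
            <= ratr (tnth q.2 i) + 2 * ratr q.1.
Proof.
have e i : ratr (tnth (triple q).2 i) = ratr (tnth q.2 i) - ratr q.1 :> R.
  by rewrite tnth_mktuple rmorphB.
have e1 : ratr (triple q).1 = ratr q.1 * 3 :> R by rewrite rmorphM/= ratr_nat.
rewrite rat_cubeP; split=> + i => /(_ i); rewrite e e1; lra.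
Qed.

Lemma rat_cube_sub_triple q q' : ratr q.1 <= ratr q'.1 :> R ->
  rat_cube q `&` rat_cube q' !=set0 -> rat_cube q `<=` rat_cube (triple q').
Proof.
move=> qq' [x [/rat_cubeP qx /rat_cubeP q'x]] y /rat_cubeP qy.
apply/rat_cube_tripleP => i.
have := qx i; have := q'x i; have := qy i; lra.
Qed.

(** The side [s] is taken in the interval (3l/2, 2l) and the corner [c] less
    than l/2 below [a] in each coordinate, by density of the rationals. *)
Lemma cube_sub_rat_cube a l : 0 < l ->
  exists q, [/\ 0 < q.1, ratr q.1 <= 2 * l & cube a l `<=` rat_cube q].
Proof.
move=> l0.
have [|s] := @rat_in_itvoo R (3 / 2 * l) (2 * l); first lra.
rewrite in_itv/= => /andP[s1 s2].
have /choice[c ca] (i : 'I_n) :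
    exists c : rat, tnth a i - l / 2 < ratr c < tnth a i.
  have [|c] := @rat_in_itvoo R (tnth a i - l / 2) (tnth a i); first lra.
  by rewrite in_itv/=; exists c.
exists (s, [tuple c i | i < n]); split => /=.
- by rewrite -(ltr0q R); lra.
- lra.
- move=> x ax; apply/rat_cubeP => i /=; rewrite tnth_mktuple.
  by have := ax i; rewrite in_itv/=; have := ca i; lra.
Qed.

End geometry.

(** * The maximal operator over rational cubes *)

Section rational_maximal.
Context {R : realType} {n : nat}.
Implicit Types (x y a : Rn R n) (l : R) (q : rat * n.-tuple rat).
Implicit Types (u : Rn R n -> R).
Local Open Scope ereal_scope.

Definition rat_average u q : \bar R :=
  ((ratr q.1 ^+ n)^-1)%:E * \int[lebesgueRn]_(y in rat_cube q) `|(u y)%:E|.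

Definition rat_maximal u x : \bar R := ereal_sup
  [set rat_average u q | q in [set q | (0 < q.1)%R /\ rat_cube q x]].

Lemma measurable_rat_cube q : measurable (rat_cube q : set (Rn R n)).
Proof. exact: measurable_cube. Qed.

Lemma cube_corner a l : (0 <= l)%R -> cube a l a.
Proof. by move=> l0 i; rewrite in_itv/= lexx lerDl. Qed.

Lemma rat_average_ge0 u q : (0 < q.1)%R -> 0 <= rat_average u q.
Proof.
move=> q0; apply: mule_ge0; last exact: integral_ge0.
by rewrite lee_fin invr_ge0 exprn_ge0// ler0q ltW.
Qed.

Lemma rat_maximal_ge0 u x : 0 <= rat_maximal u x.
Proof.
have [q [q0 _ qx]] := @cube_sub_rat_cube R n x 1%R ltr01.
apply: (le_trans (rat_average_ge0 u q0)).
by apply: ereal_sup_ubound; exists q => //; split => //; exact/qx/cube_corner.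
Qed.

Lemma rat_maximal_le_maximal u x : rat_maximal u x <= maximal u x.
Proof.
apply: ereal_sup_le => _ [q [q0 qx] <-]; exists (rat_cube q).
  by exists (rat_point q.2), (ratr q.1); split => //; rewrite ltr0q.
rewrite lebesgueRn_cube ?ltr0q// inver gt_eqF// exprn_gt0// ltr0q//.
Qed.

(** Each superlevel set is a union of rational cubes, hence a countable one. *)
Lemma measurable_rat_maximal u : measurable_fun [set: Rn R n] (rat_maximal u).
Proof.
move=> mT; apply: (measurability _ (ErealGenOInfty.measurableE R)) => //.
move=> _ [_ [c ->] <-].
pose S q : set (Rn R n) :=
  if (0 < q.1)%R && (c%:E < rat_average u q) then rat_cube q else set0.
suff -> : [set: Rn R n] `&` rat_maximal u @^-1` `]c%:E, +oo[%classic =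
    \bigcup_q S q.
  apply: countable_bigcupT_measurable => // q; rewrite /S; case: ifP => // _.
  exact: measurable_rat_cube.
rewrite setTI; apply/seteqP; split => x /=.
  rewrite in_itv/= andbT => /ereal_sup_gt[_ [q [q0 qx] <-] cq].
  by exists q => //; rewrite /S q0 cq.
move=> [q _]; rewrite /S; case: ifPn => // /andP[q0 cq] qx.
rewrite in_itv/= andbT; apply: (lt_le_trans cq).
by apply: ereal_sup_ubound; exists q.
Qed.

Lemma integral_rat_cube_le u q x : (0 < q.1)%R -> rat_cube q x ->
  \int[lebesgueRn]_(y in rat_cube q) `|(u y)%:E| <=
  (ratr q.1 ^+ n)%:E * rat_maximal u x.
Proof.
move=> q0 qx; have l0 : (0 < ratr q.1 ^+ n :> R)%R by rewrite exprn_gt0// ltr0q.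
have : rat_average u q <= rat_maximal u x.
  by apply: ereal_sup_ubound; exists q.
rewrite /rat_average -(@lee_pmul2l _ (ratr q.1 ^+ n)%:E)// muleA -EFinM.
by rewrite divff ?gt_eqF// mul1e.
Qed.

(** The factor 2 in front of the side is the price of replacing the cube by a
    rational one. *)
Lemma integral_cube_le u a l x : measurable_fun [set: Rn R n] u ->
  (0 < l)%R -> cube a l x ->
  \int[lebesgueRn]_(y in cube a l) `|(u y)%:E| <=
  ((2 * l) ^+ n)%:E * rat_maximal u x.
Proof.
move=> mu l0 ax; have [q [q0 ql aq]] := cube_sub_rat_cube a l0.
apply: (@le_trans _ _ ((ratr q.1 ^+ n)%:E * rat_maximal u x)).
  apply: (le_trans _ (integral_rat_cube_le _ q0 (aq _ ax))).
  by apply: ge0_le_integral_sub => // y _; rewrite abse_ge0 lexx.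
apply: lee_wpmul2r; first exact: rat_maximal_ge0.
by rewrite lee_fin lerXn2r// nnegrE ?ler0q ?ltW// mulr_gt0.
Qed.

Lemma maximal_gt_rat_cube (g : Rn R n -> R) x (s : R) : (0 <= s)%R ->
  s%:E < maximal g x -> exists q, [/\ (0 < q.1)%R, rat_cube q x &
    (s / 2 ^+ n * ratr q.1 ^+ n)%:E <
    \int[lebesgueRn]_(y in rat_cube q) `|(g y)%:E|].
Proof.
move=> s0 /ereal_sup_gt[_ [_ [a [l [l0 -> ax]]] <-]].
rewrite lebesgueRn_cube// inver gt_eqF ?exprn_gt0// => sg.
have [q [q0 ql aq]] := cube_sub_rat_cube a l0.
exists q; split => //; first exact: aq.
apply: (@lt_le_trans _ _ (\int[lebesgueRn]_(y in cube a l) `|(g y)%:E|));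
  last first.
  by apply: ge0_le_integral_sub => // y _; rewrite abse_ge0 lexx.
apply: (@le_lt_trans _ _ (s * l ^+ n)%:E).
  rewrite lee_fin -mulrA ler_wpM2l// mulrC ler_pdivrMr ?exprn_gt0//.
  rewrite -exprMn [(l * 2)%R]mulrC lerXn2r ?nnegrE ?ler0q ?mulr_ge0 //;
    exact: ltW.
move: sg; rewrite -(@lte_pmul2l _ (l ^+ n)%:E) ?lte_fin ?exprn_gt0//.
by rewrite muleA -!EFinM divff ?gt_eqF ?exprn_gt0// mul1e mulrC.
Qed.

End rational_maximal.

(** * Power weights and averages *)

Section weights.
Context {R : realType} {n : nat}.
Implicit Types (x y : Rn R n).

Definition sup_weight (p : R) x : R := sup_norm x `^ (- p).

Lemma ler_powRN (p s t : R) :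
  0 <= p -> 0 < s -> s <= t -> t `^ (- p) <= s `^ (- p).
Proof.
move=> p0 s0 st; rewrite !powRN lef_pV2 ?posrE ?powR_gt0 ?(lt_le_trans s0)//.
by apply: ge0_ler_powR => //; rewrite nnegrE ltW// (lt_le_trans s0).
Qed.

Lemma powRN_half (p s : R) : 0 <= s -> (s / 2) `^ (- p) = 2 `^ p * s `^ (- p).
Proof.
move=> s0; rewrite powRM ?invr_ge0// mulrC; congr (_ * _).
by rewrite -powR_inv1// -powRrM mulN1r opprK.
Qed.

Lemma powR_exprnC (a s : R) j : 0 <= a -> (a ^+ j) `^ s = (a `^ s) ^+ j.
Proof.
move=> a0; elim: j => [|j IH]; first by rewrite !expr0 powR1.
by rewrite !exprS powRM ?exprn_ge0// IH.
Qed.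

Lemma powR2N_lt1 (p : R) : 0 < p -> 2 `^ (- p) < 1.
Proof.
move=> p0; rewrite powRN invf_lt1 ?powR_gt0//.
have := @gt0_ltr_powR R p p0 1 2; rewrite powR1 !nnegrE; apply => //.
by rewrite ltr1n.
Qed.

(** Take the least [j] for which the upper bound holds. *)
Lemma dyadic_shell (rho N : R) : 0 < rho -> rho <= N ->
  exists j, 2 ^+ j * rho <= N <= 2 * (2 ^+ j * rho).
Proof.
move=> rho0 rhoN.
have ex : exists j, N <= 2 * (2 ^+ j * rho).
  exists (Num.bound (N / rho)).
  have := upper_nthrootP (leqnn (Num.bound (N / rho))).
  rewrite ltr_pdivrMr// => h; apply: (le_trans (ltW h)).
  have : 0 <= 2 ^+ Num.bound (N / rho) * rho.
    by rewrite mulr_ge0 ?exprn_ge0 ?ltW.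
  by lra.
have [j jN jmin] := ex_minnP ex; case: j jN jmin => [|j] jN jmin.
  by exists 0%N; rewrite jN expr0 mul1r rhoN.
exists j.+1; rewrite jN andbT leNgt; apply/negP => h.
by have := jmin j; rewrite ltnn mulrA -exprS ltW// => /(_ isT).
Qed.

(** The exponent [p - n], positive in the application, governs both the size
    condition on inner balls and the convergence of the tail. *)
Lemma powRN_exprn (p s : R) :
  0 < s -> s `^ (- p) * s ^+ n = s `^ (- (p - n%:R)).
Proof.
move=> s0; rewrite -powR_mulrn ?ltW// -powRD ?(gt_eqF s0) ?implybT//.
by congr (_ `^ _); ring.
Qed.

Lemma measurable_sup_weight (p : R) :
  measurable_fun [set: Rn R n] (sup_weight p).
Proof.
exact: (measurableT_comp (measurable_powR _) measurable_sup_norm).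
Qed.

Lemma sup_weight_ge0 (p : R) x : 0 <= sup_weight p x.
Proof. exact: powR_ge0. Qed.

Definition sup_ball (s : R) : set (Rn R n) := [set x | sup_norm x <= s].

Lemma sup_ball_cube (s : R) : 0 <= s ->
  sup_ball s = cube [tuple - s | i < n] (2 * s).
Proof.
move=> s0; apply/seteqP; split => x /= xs.
  move=> i; have := le_trans (ler_sup_norm x i) xs.
  by rewrite in_itv/= tnth_mktuple ler_norml; lra.
apply: sup_norm_le => // i; have := xs i.
by rewrite in_itv/= tnth_mktuple ler_norml; lra.
Qed.

Lemma measurable_sup_ball (s : R) : measurable (sup_ball s).
Proof.
have [s0|s0] := leP 0 s.
  by rewrite sup_ball_cube//; exact: measurable_cube.
suff -> : sup_ball s = set0 by exact: measurable0.
apply/seteqP; split => // x /= xs.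
by have := sup_norm_ge0 x; rewrite leNgt (le_lt_trans xs s0).
Qed.

Local Open Scope ereal_scope.

Lemma integral_sup_ball_le (u : Rn R n -> R) (s : R) y :
  measurable_fun [set: Rn R n] u -> (0 < s)%R -> sup_ball s y ->
  \int[lebesgueRn]_(x in sup_ball s) `|(u x)%:E| <=
  ((4 * s) ^+ n)%:E * rat_maximal u y.
Proof.
move=> mu s0; rewrite (sup_ball_cube (ltW s0)) => sy.
rewrite (_ : 4 * s = 2 * (2 * s))%R; last by ring.
by apply: integral_cube_le => //; rewrite mulr_gt0.
Qed.

End weights.

Section averaging.
Local Open Scope ereal_scope.
Context d (T : measurableType d) (R : realType).
Variable mu : {measure set T -> \bar R}.

(** A bound of [A] by [b * M] at every point of [D] is integrated against [g],
    whose mass on [D] is at least [t * b].  The value [A] may be infinite. *)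
Lemma le_integral_of_average (D : set T) (g M : T -> \bar R)
    (A : \bar R) (b t : R) :
  measurable D -> measurable_fun [set: T] g -> measurable_fun [set: T] M ->
  (forall x, 0 <= g x) -> (forall x, 0 <= M x) -> 0 <= A ->
  (0 < b)%R -> (0 < t)%R ->
  (forall y, D y -> A <= b%:E * M y) -> (t * b)%:E <= \int[mu]_(y in D) g y ->
  A <= (t^-1)%:E * \int[mu]_(y in D) (g y * M y).
Proof.
move=> mD mg mM g0 M0 A0 b0 t0 AM tb.
rewrite -(@lee_pmul2l _ t%:E)// muleA -EFinM divff ?gt_eqF// mul1e.
pose c := (b^-1)%:E * A.
have c0 : 0 <= c by rewrite mule_ge0// lee_fin invr_ge0 ltW.
have cM y : D y -> c <= M y.
  move=> /AM; rewrite -(@lee_pmul2l _ (b^-1)%:E) ?lte_fin ?invr_gt0// muleA.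
  by rewrite -EFinM mulVf ?gt_eqF// mul1e.
apply: (@le_trans _ _ (\int[mu]_(y in D) (g y * c))); last first.
  apply: ge0_le_integral_sub => // [y /cM cy|y _]; last by rewrite mule_ge0.
  by rewrite mule_ge0//= lee_wpmul2l.
rewrite ge0_integralZr//; last exact: measurable_funTS.
apply: (@le_trans _ _ ((t * b)%:E * c)); last exact: lee_wpmul2r.
by rewrite /c muleA -EFinM mulfK ?gt_eqF.
Qed.
End averaging.

(** * The near, inner and outer estimates *)

Section mixed_estimates.
Context {R : realType} {n : nat}.
Context (u g : Rn R n -> R) (p : R).
Context (u_ge0 : forall x, 0 <= u x) (m_u : measurable_fun [set: Rn R n] u).
Context (g_ge0 : forall x, 0 <= g x) (m_g : measurable_fun [set: Rn R n] g).
Context (np : n%:R < p).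
Let p_ge0 : 0 <= p. Proof. by rewrite ltW// (le_lt_trans _ np). Qed.
Let d0 : 0 < p - n%:R. Proof. by rewrite subr_gt0. Qed.
Local Open Scope ereal_scope.
Local Notation w := (@sup_weight R n p).
Local Notation M := (rat_maximal u).

Let abs_u (D : set (Rn R n)) :
  \int[lebesgueRn]_(x in D) `|(u x)%:E| = \int[lebesgueRn]_(x in D) (u x)%:E.
Proof. by apply: eq_integral => x _; rewrite gee0_abs ?lee_fin. Qed.

Let uw_ge0 x : 0 <= (u x * w x)%:E.
Proof. by rewrite lee_fin mulr_ge0// sup_weight_ge0. Qed.

Let m_uw : measurable_fun [set: Rn R n] (fun x => (u x * w x)%:E).
Proof.
apply/measurable_EFinP.
exact: (measurable_funM m_u (measurable_sup_weight p)).
Qed.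

Let mEu : measurable_fun [set: Rn R n] (EFin \o u).
Proof. exact/measurable_EFinP. Qed.

Let mEg : measurable_fun [set: Rn R n] (EFin \o g).
Proof. exact/measurable_EFinP. Qed.

Let gM_ge0 x : 0 <= (g x)%:E * M x.
Proof. by rewrite mule_ge0 ?lee_fin// rat_maximal_ge0. Qed.

Let m_gM : measurable_fun [set: Rn R n] (fun x => (g x)%:E * M x).
Proof. exact: (emeasurable_funM mEg (measurable_rat_maximal u)). Qed.

Let average_le (D : set (Rn R n)) (A : \bar R) (b t : R) :
  measurable D -> 0 <= A -> (0 < b)%R -> (0 < t)%R ->
  (forall y, D y -> A <= b%:E * M y) ->
  (t * b)%:E <= \int[lebesgueRn]_(y in D) (g y)%:E ->
  A <= (t^-1)%:E * \int[lebesgueRn]_(y in D) ((g y)%:E * M y).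
Proof.
move=> mD; apply: (@le_integral_of_average _ (Rn R n) R lebesgueRn D
  (EFin \o g) M A b t mD mEg).
- exact: measurable_rat_maximal.
- by move=> y; rewrite lee_fin.
- exact: rat_maximal_ge0.
Qed.

(** Cubes that are small compared with their distance to the origin and on
    which the average of [g] is large compared with the weight. *)
Definition near_cubes (t : R) : set (rat * n.-tuple rat) :=
  [set q | (0 < q.1)%R /\ exists x, [/\ rat_cube q x, (0 < sup_norm x)%R,
     (4 * ratr q.1 <= sup_norm x)%R &
     (t * (w x * ratr q.1 ^+ n))%:E <=
       \int[lebesgueRn]_(y in rat_cube q) (g y)%:E]].

(** On the triple of a near cube the weight is at most [2^p] times its value at
    the witness [x], and the average of [u] on the triple is at most the maximal
    function at each point of the cube; [weak_type_of_covering] does the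
    rest. *)
Lemma near_estimate (t : R) : (0 < t)%R ->
  \int[lebesgueRn]_(x in \bigcup_(q in near_cubes t) rat_cube q)
    (u x * w x)%:E <=
  (2 `^ p * 3 ^+ n / t)%:E * \int[lebesgueRn]_x ((g x)%:E * M x).
Proof.
move=> t0; set K := (2 `^ p * 3 ^+ n)%R.
have K0 : (0 < K)%R by rewrite mulr_gt0 ?powR_gt0 ?exprn_gt0.
have Kt0 : (0 <= K / t)%R by rewrite divr_ge0// ltW.
rewrite -ge0_integralZl_EFin//.
have mk : measurable_fun [set: Rn R n] (fun x => (K / t)%:E * ((g x)%:E * M x)).
  by apply: emeasurable_funM => //; exact: measurable_cst.
have k_ge0 x : 0 <= (K / t)%:E * ((g x)%:E * M x) by rewrite mule_ge0.
have := @weak_type_of_covering _ (Rn R n) R lebesgueRn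
  (rat * n.-tuple rat)%type (@rat_cube R n)
  (fun q => rat_cube (triple q)) (fun q => ratr q.1 : R) (near_cubes t)
  (fun x => (u x * w x)%:E) (fun x => (K / t)%:E * ((g x)%:E * M x)).
apply => //.
- by move=> q; exact: measurable_rat_cube.
- by move=> q; exact: measurable_rat_cube.
- by move=> q q'; exact: rat_cube_sub_triple.
move=> q [q0 [x [qx x0 qle tq]]].
have l0 : (0 < ratr q.1 :> R)%R by rewrite ltr0q.
have mQ : measurable (rat_cube q : set (Rn R n)) by exact: measurable_rat_cube.
have mQ' : measurable (rat_cube (triple q) : set (Rn R n)).
  exact: measurable_rat_cube.
have m_gM' : measurable_fun (rat_cube q) (fun x => (g x)%:E * M x).
  exact: measurable_funTS.
rewrite (ge0_integralZl_EFin _ mQ _ m_gM' Kt0)//.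
have wx0 : (0 < w x)%R by rewrite powR_gt0.
(* the factor such that [uw] of the triple is at most [b * M y] on the cube *)
pose b := (K * (w x * ratr q.1 ^+ n))%R.
have b0 : (0 < b)%R by rewrite !mulr_gt0// exprn_gt0.
rewrite -[(K / t)%R]invf_div.
apply: (average_le mQ _ b0).
- exact: integral_ge0.
- by rewrite divr_gt0.
- move=> y qy.
  have q'y : rat_cube (triple q) y.
    by apply: rat_cube_sub_triple qy => //; exists x.
  apply: (@le_trans _ _ (\int[lebesgueRn]_(z in rat_cube (triple q))
      ((2 `^ p * w x)%:E * (u z)%:E))).
    apply: ge0_le_integral_sub => // z q'z; last first.
      by rewrite -EFinM lee_fin mulr_ge0// mulr_ge0 ?powR_ge0.
    rewrite uw_ge0/= -EFinM lee_fin mulrC ler_wpM2r//.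
    rewrite /sup_weight -powRN_half ?sup_norm_ge0//.
    apply: ler_powRN => //; first by rewrite divr_gt0.
    have := @sup_norm_dist _ _ x z (2 * ratr q.1).
    rewrite ler_pdivrMr// => xz.
    suff : (sup_norm x <= sup_norm z + 2 * ratr q.1)%R by lra.
    apply: xz => [|i]; first by rewrite mulr_ge0// ltW.
    move: qx q'z => /rat_cubeP/(_ i) qx /rat_cube_tripleP/(_ i) q'z.
    by rewrite ler_norml; lra.
  have c0 : (0 <= 2 `^ p * w x)%R by rewrite mulr_ge0 ?powR_ge0.
  have mEu' : measurable_fun (rat_cube (triple q)) (EFin \o u).
    exact: measurable_funTS.
  rewrite (ge0_integralZl_EFin lebesgueRn mQ' _ mEu' c0); last first.
    by move=> z _; rewrite lee_fin.
  rewrite -abs_u.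
  have q'0 : (0 < (triple q).1)%R by rewrite mulr_gt0.
  apply: (@le_trans _ _ ((2 `^ p * w x)%:E *
      ((ratr (triple q).1 ^+ n)%:E * M y))).
    apply: lee_wpmul2l; first by rewrite lee_fin mulr_ge0 ?powR_ge0.
    exact: integral_rat_cube_le.
  rewrite muleA -EFinM /b /K rmorphM/= ratr_nat exprMn.
  by rewrite le_eqVlt; apply/orP; left; apply/eqP; congr (_%:E * _); ring.
- by rewrite /b mulrA divfK// gt_eqF.
Qed.

(** On the shell where N is between [2^j * rho] and [2^(j+1) * rho] the weight
    is at most [(2^j * rho)^(-p)], and the integral of [u] on the enclosing ball
    is at most [(8 * 2^j * rho)^n * M y].  The products form a geometric series
    of ratio [2^(n-p) < 1]. *)
Lemma tail_estimate (rho : R) y : (0 < rho)%R -> (sup_norm y <= 2 * rho)%R ->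
  \int[lebesgueRn]_(x in [set x | (rho <= sup_norm x)%R]) (u x * w x)%:E <=
  (8 ^+ n / (1 - 2 `^ (- (p - n%:R))) * rho `^ (- (p - n%:R)))%:E * M y.
Proof.
move=> rho0 yrho.
set a := (2 `^ (- (p - n%:R)))%R; set c := (8 ^+ n * rho `^ (- (p - n%:R)))%R.
have a0 : (0 < a)%R by rewrite powR_gt0.
have a1 : (a < 1)%R by exact: powR2N_lt1.
have c0 : (0 <= c)%R by rewrite mulr_ge0 ?powR_ge0// exprn_ge0.
pose s j : R := (2 ^+ j * rho)%R.
have s0 j : (0 < s j)%R by rewrite mulr_gt0 ?exprn_gt0.
pose F j x := ((s j) `^ (- p))%:E * ((EFin \o u) \_ (sup_ball (2 * s j))) x.
have F0 j x : 0 <= F j x.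
  rewrite mule_ge0 ?lee_fin ?powR_ge0//.
  by apply: erestrict_ge0 => z _; rewrite lee_fin.
have mB j : measurable (sup_ball (2 * s j) : set (Rn R n)).
  exact: measurable_sup_ball.
have mR j : measurable_fun [set: Rn R n] ((EFin \o u) \_ (sup_ball (2 * s j))).
  by apply/(measurable_restrictT _ (mB j)).1; exact: measurable_funTS.
have mF j : measurable_fun [set: Rn R n] (F j).
  by apply: emeasurable_funM (mR j); exact: measurable_cst.
apply: (@le_trans _ _ (\int[lebesgueRn]_x (\sum_(0 <= j <oo) F j x))).
  apply: ge0_le_integral_sub => // x; last by move=> _; exact: nneseries_ge0.
  move=> /= /(dyadic_shell rho0)[j /andP[jx xj]].
  rewrite uw_ge0/=.
  apply: (@le_trans _ _ (F j x)).
    rewrite /F patchE mem_set//= -EFinM lee_fin mulrC ler_wpM2r//.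
    by apply: ler_powRN.
  apply: (le_trans _ (@nneseries_lim_ge _ _ xpredT 0 j.+1 _)) => //.
  by rewrite big_nat_recr//= leeDr// sume_ge0.
rewrite (integral_nneseries lebesgueRn measurableT mF (fun j x _ => F0 j x)).
apply: lime_le.
  by apply: is_cvg_nneseries => j _ _; exact: integral_ge0.
apply: nearW => N.
have iF j : \int[lebesgueRn]_x F j x <= (c * a ^+ j)%:E * M y.
  have R0 x : [set: Rn R n] x -> 0 <= ((EFin \o u) \_ (sup_ball (2 * s j))) x.
    by move=> _; apply: erestrict_ge0 => z _; rewrite lee_fin.
  rewrite (ge0_integralZl_EFin lebesgueRn measurableT R0 (mR j) (powR_ge0 _ _)).
  rewrite -integral_mkcond -abs_u.
  have yB : sup_ball (2 * s j) y.
    apply: (le_trans yrho); rewrite ler_pM2l// ler_peMl//; first exact: ltW.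
    by rewrite exprn_ege1// ler1n.
  have s20 : (0 < 2 * s j)%R by rewrite mulr_gt0.
  apply: (@le_trans _ _ ((s j `^ (- p))%:E *
      (((4 * (2 * s j)) ^+ n)%:E * M y))).
    apply: lee_wpmul2l; first by rewrite lee_fin powR_ge0.
    exact: integral_sup_ball_le.
  rewrite muleA -EFinM.
  suff -> : (s j `^ (- p) * (4 * (2 * s j)) ^+ n = c * a ^+ j)%R by [].
  rewrite mulrA -natrM exprMn mulrCA powRN_exprn// /c -mulrA; congr (_ * _)%R.
  rewrite /s powRM ?exprn_ge0 ?ltW// mulrC; congr (_ * _)%R.
  by rewrite powR_exprnC.
apply: (@le_trans _ _ (\sum_(0 <= j < N) ((c * a ^+ j)%:E * M y))).
  exact: lee_sum.
rewrite -ge0_sume_distrl; last first.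
  by move=> j _; rewrite lee_fin mulr_ge0 ?exprn_ge0// ltW.
rewrite sumEFin; apply: lee_wpmul2r; first exact: rat_maximal_ge0.
rewrite lee_fin mulrAC -/c.
by apply: (geometric_le_lim N c0 a0); rewrite gtr0_norm.
Qed.

(** Rational radii, so that the exterior domains attached to them form a
    countable family.  The ball has radius twice the rational [q]: an arbitrary
    radius in (q, 2q) is then replaced by [q] without shrinking the ball. *)
Definition inner_radii (t : R) : set rat :=
  [set q | (0 < q)%R /\ (t * (ratr q) `^ (- (p - n%:R)))%:E <=
    \int[lebesgueRn]_(y in sup_ball (2 * ratr q)) (g y)%:E].

Definition sup_exterior (s : R) : set (Rn R n) := [set x | (s <= sup_norm x)%R].

Lemma measurable_sup_exterior (s : R) : measurable (sup_exterior s).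
Proof.
have := @measurable_sup_norm R n measurableT `[s, +oo[%classic
  (measurable_itv _).
rewrite setTI; congr measurable; apply/seteqP.
by split => x /=; rewrite in_itv/= andbT.
Qed.

(** The lower bound on the mass of [g] compensates the factor [q^(n-p)] in
    [tail_estimate], for one radius at a time; [integral_bigcup_chain_le] passes
    to the union. *)
Lemma inner_estimate (t : R) : (0 < t)%R ->
  \int[lebesgueRn]_(x in \bigcup_(q in inner_radii t) sup_exterior (ratr q))
    (u x * w x)%:E <=
  (8 ^+ n / (1 - 2 `^ (- (p - n%:R))) / t)%:E *
    \int[lebesgueRn]_x ((g x)%:E * M x).
Proof.
move=> t0; set K := (8 ^+ n / _)%R.
have K0 : (0 < K)%R.
  by rewrite divr_gt0 ?exprn_gt0// subr_gt0 powR2N_lt1.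
have Kt0 : (0 <= K / t)%R by rewrite divr_ge0// ltW.
have RHS0 : 0 <= (K / t)%:E * \int[lebesgueRn]_x ((g x)%:E * M x).
  by apply: mule_ge0 => //; apply: integral_ge0.
apply: integral_bigcup_chain_le => //.
- by move=> q; exact: measurable_sup_exterior.
- move=> q q'; have [qq'|q'q] := leP (ratr q : R) (ratr q').
    by right => x; exact: le_trans.
  by left => x; apply: le_trans; exact: ltW.
move=> q [q0 tq].
have l0 : (0 < ratr q :> R)%R by rewrite ltr0q.
have mB : measurable (sup_ball (2 * ratr q) : set (Rn R n)).
  exact: measurable_sup_ball.
have b0 : (0 < K * ratr q `^ (- (p - n%:R)))%R by rewrite mulr_gt0// powR_gt0.
apply: (@le_trans _ _ ((K / t)%:E *
    \int[lebesgueRn]_(y in sup_ball (2 * ratr q)) ((g y)%:E * M y))).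
  rewrite -[(K / t)%R]invf_div; apply: (average_le mB _ b0).
  - exact: integral_ge0.
  - by rewrite divr_gt0.
  - by move=> y yB; exact: tail_estimate.
  - by rewrite mulrA divfK// gt_eqF.
apply: lee_wpmul2l => //.
by apply: ge0_le_integral_sub => // x _; rewrite gM_ge0 lexx.
Qed.

(** Its integral in the second variable is the integral of [g / N^n] over the
    exterior of the ball through the first variable: a Hardy operator. *)
Definition outer_density (z : Rn R n * Rn R n) : R :=
  g z.2 * sup_weight n%:R z.2 *
  \1_[set z : Rn R n * Rn R n | (sup_norm z.1 < sup_norm z.2)%R] z.

Definition outer_kernel (z : Rn R n * Rn R n) : \bar R :=
  (u z.1 * outer_density z)%:E.

Lemma outer_density_ge0 z : (0 <= outer_density z)%R.
Proof. by rewrite !mulr_ge0// sup_weight_ge0. Qed.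

Lemma outer_kernel_ge0 z : 0 <= outer_kernel z.
Proof. by rewrite lee_fin mulr_ge0// outer_density_ge0. Qed.

Lemma measurable_outer_density :
  measurable_fun [set: Rn R n * Rn R n] outer_density.
Proof.
have mN1 : measurable_fun [set: Rn R n * Rn R n] (fun z => sup_norm z.1).
  exact: (measurableT_comp measurable_sup_norm measurable_fst).
have mN2 : measurable_fun [set: Rn R n * Rn R n] (fun z => sup_norm z.2).
  exact: (measurableT_comp measurable_sup_norm measurable_snd).
apply: measurable_funM; first apply: measurable_funM.
- exact: (measurableT_comp m_g measurable_snd).
- exact: (measurableT_comp (measurable_sup_weight n%:R) measurable_snd).
have -> : [set z : Rn R n * Rn R n | (sup_norm z.1 < sup_norm z.2)%R] =
  (fun z => (sup_norm z.1 < sup_norm z.2)%R) @^-1` [set true] by [].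
apply: measurable_indic; rewrite -[X in measurable X]setTI.
exact: (measurable_fun_ltr mN1 mN2).
Qed.

Lemma measurable_outer_kernel :
  measurable_fun [set: Rn R n * Rn R n] outer_kernel.
Proof.
apply/measurable_EFinP; apply: measurable_funM measurable_outer_density.
exact: (measurableT_comp m_u measurable_fst).
Qed.

(** After exchanging the integrals, the inner one is the mass of [u] on the ball
    of radius N(y), divided by N(y)^n. *)
Lemma outer_estimate :
  \int[lebesgueRn]_x \int[lebesgueRn]_y outer_kernel (x, y) <=
  (4 ^+ n)%:E * \int[lebesgueRn]_x ((g x)%:E * M x).
Proof.
rewrite (fubini_tonelli outer_kernel measurable_outer_kernel outer_kernel_ge0).
rewrite -(ge0_integralZl_EFin lebesgueRn measurableT (fun x _ => gM_ge0 x)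
  m_gM);
  last exact: exprn_ge0.
apply: ge0_le_integral_sub => // [y _|y _]; last first.
  by rewrite mule_ge0 ?lee_fin ?exprn_ge0.
apply/andP; split.
  by apply: integral_ge0 => x _; exact: outer_kernel_ge0.
(* at the origin the kernel vanishes, since no point has a smaller norm *)
have := sup_norm_ge0 y; rewrite le_eqVlt => /predU1P[y0|y0].
  rewrite integral0_eq => [|x _].
    by apply: mule_ge0 => //; rewrite lee_fin exprn_ge0.
  rewrite /outer_kernel/outer_density/= indicE memNset ?mulr0//= -y0.
  by apply/negP; rewrite -leNgt sup_norm_ge0.
pose c := (g y * sup_weight n%:R y)%R.
have c0 : (0 <= c)%R by rewrite mulr_ge0// sup_weight_ge0.
have mB : measurable (sup_ball (sup_norm y) : set (Rn R n)).
  exact: measurable_sup_ball.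
apply: (@le_trans _ _
    (\int[lebesgueRn]_(x in sup_ball (sup_norm y)) (c%:E * (u x)%:E))).
  rewrite [leRHS]integral_mkcond.
  apply: ge0_le_integral_sub => // x _; last first.
    by apply: erestrict_ge0 => z _; rewrite -EFinM lee_fin mulr_ge0.
  rewrite outer_kernel_ge0/= patchE; case: ifPn => [_|].
    rewrite /outer_kernel/outer_density/= -/c -EFinM lee_fin mulrC.
    by rewrite ler_wpM2r// ler_piMr.
  rewrite notin_setE /sup_ball/= => /negP; rewrite -ltNge => yx.
  rewrite /outer_kernel/outer_density/= indicE memNset ?mulr0//=.
  by apply/negP; rewrite -leNgt ltW.
have mEu' : measurable_fun (sup_ball (sup_norm y)) (EFin \o u).
  exact: measurable_funTS.
rewrite (ge0_integralZl_EFin lebesgueRn mB _ mEu' c0); last first.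
  by move=> z _; rewrite lee_fin.
rewrite -abs_u.
apply: (@le_trans _ _ (c%:E * (((4 * sup_norm y) ^+ n)%:E * M y))).
  apply: lee_wpmul2l => //.
  by apply: integral_sup_ball_le => //; rewrite /sup_ball/=.
rewrite !muleA -!EFinM.
suff -> : (c * (4 * sup_norm y) ^+ n = 4 ^+ n * g y)%R by [].
rewrite exprMn mulrCA; congr (_ * _)%R; rewrite /c -mulrA /sup_weight.
by rewrite powRN_exprn// subrr oppr0 powRr0 mulr1.
Qed.

Lemma measurable_outer_integral : measurable_fun [set: Rn R n]
  (fun x => \int[lebesgueRn]_y outer_kernel (x, y)).
Proof.
exact: (measurable_fun_fubini_tonelli_F outer_kernel measurable_outer_kernel
  outer_kernel_ge0).
Qed.

Lemma measurable_outer_section x :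
  measurable_fun [set: Rn R n] (fun y => (outer_density (x, y))%:E).
Proof.
apply/measurable_EFinP.
exact: (measurableT_comp measurable_outer_density (pair1_measurable x)).
Qed.

(** A cube of side [l] containing [x] with N(x) < 4l lies in the ball N <= 5l,
    so that outside the ball N <= N(x) one has 1 <= (5l)^n * N(y)^(-n). *)
Lemma integral_rat_cube_split q x : (0 < q.1)%R -> rat_cube q x ->
  (sup_norm x < 4 * ratr q.1)%R ->
  \int[lebesgueRn]_(y in rat_cube q) (g y)%:E <=
  \int[lebesgueRn]_(y in sup_ball (sup_norm x)) (g y)%:E +
  ((5 * ratr q.1) ^+ n)%:E * \int[lebesgueRn]_y (outer_density (x, y))%:E.
Proof.
move=> q0 qx xq; pose k y := outer_density (x, y).
have l0 : (0 < ratr q.1 :> R)%R by rewrite ltr0q.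
have c0 : (0 <= (5 * ratr q.1 : R) ^+ n)%R.
  by rewrite exprn_ge0// mulr_ge0// ltW.
have k0 y : (0 <= k y)%R by exact: outer_density_ge0.
have k0' y : [set: Rn R n] y -> 0 <= (k y)%:E by rewrite lee_fin.
have mk : measurable_fun [set: Rn R n] (fun y => (k y)%:E).
  exact: measurable_outer_section.
rewrite -(ge0_integralZl_EFin lebesgueRn measurableT k0' mk c0).
have ck0 y : [set: Rn R n] y -> 0 <= ((5 * ratr q.1) ^+ n)%:E * (k y)%:E.
  by move=> _; rewrite -EFinM lee_fin mulr_ge0.
have mck : measurable_fun [set: Rn R n]
    (fun y => ((5 * ratr q.1) ^+ n)%:E * (k y)%:E).
  exact: (emeasurable_funM (measurable_cst _) mk).
have gB0 y : [set: Rn R n] y -> 0 <= ((EFin \o g) \_ (sup_ball (sup_norm x))) y.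
  by move=> _; apply: erestrict_ge0 => z _; rewrite lee_fin.
have mB : measurable (sup_ball (sup_norm x) : set (Rn R n)).
  exact: measurable_sup_ball.
have mgB : measurable_fun [set: Rn R n]
    ((EFin \o g) \_ (sup_ball (sup_norm x))).
  by apply/(measurable_restrictT _ mB).1; exact: measurable_funTS.
rewrite [X in _ <= X + _]integral_mkcond.
rewrite -(ge0_integralD lebesgueRn measurableT gB0 mgB ck0 mck).
apply: ge0_le_integral_sub => // y; last first.
  by move=> _; apply: adde_ge0; [exact: gB0|exact: ck0].
move=> qy; rewrite lee_fin g_ge0/= patchE; case: ifPn => [_|].
  by rewrite leeDl// -EFinM lee_fin mulr_ge0.
rewrite notin_setE /sup_ball/= => /negP; rewrite -ltNge => xy.
rewrite add0e -EFinM lee_fin /k /outer_density indicE mem_set//= mulr1.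
rewrite mulrCA ler_peMr//.
have y0 : (0 < sup_norm y)%R by rewrite (le_lt_trans _ xy)// sup_norm_ge0.
rewrite /sup_weight powRN powR_mulrn ?sup_norm_ge0// ler_pdivlMr ?exprn_gt0//.
have yx : (sup_norm y <= sup_norm x + ratr q.1)%R.
  by apply: sup_norm_dist (ltW l0) _ => i; exact: cube_dist qy qx.
rewrite mul1r; apply: lerXn2r; rewrite ?nnegrE ?sup_norm_ge0//.
  by rewrite mulr_ge0// ltW.
lra.
Qed.

(** When the cube is not near, one of the two terms of
    [integral_rat_cube_split] is at least half of the lower bound for the
    integral of [g] on the cube. *)
Lemma near_inner_outer (t : R) q x : (0 < t)%R -> (0 < sup_norm x)%R ->
  (0 < q.1)%R -> rat_cube q x ->
  (t * (w x * ratr q.1 ^+ n))%:E <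
    \int[lebesgueRn]_(y in rat_cube q) (g y)%:E ->
  [\/ (\bigcup_(q in near_cubes t) rat_cube q) x,
      (\bigcup_(q in inner_radii (t / (2 * 4 ^+ n * 2 `^ (p - n%:R))))
         sup_exterior (ratr q)) x |
      (t / (2 * 5 ^+ n) * (u x * w x))%:E <=
        \int[lebesgueRn]_y outer_kernel (x, y)].
Proof.
move=> t0 x0 q0 qx tq; have l0 : (0 < ratr q.1 :> R)%R by rewrite ltr0q.
have [qle|xq] := leP (4 * ratr q.1 : R)%R (sup_norm x).
  apply: Or31; exists q => //; split => //; exists x; split => //.
  exact: ltW.
have := integral_rat_cube_split q0 qx xq; set F := integral _ (sup_ball _) _.
move=> FG.
set a := (t * (w x * ratr q.1 ^+ n))%R in tq.
have [aF|Fa] := leP (a / 2)%:E F.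
  apply: Or32.
  (* a rational radius [s] with [x] outside the ball of radius [s] but the ball
     of radius [2 * s] larger than the one through [x] *)
  have [|s] := @rat_in_itvoo R (sup_norm x / 2) (sup_norm x); first by lra.
  rewrite in_itv/= => /andP[s1 s2].
  exists s; last exact: ltW.
  have s0 : (0 < ratr s :> R)%R by lra.
  split; first by rewrite -(ltr0q R).
  apply: (@le_trans _ _ (a / 2)%:E); last first.
    apply: (le_trans aF); apply: ge0_le_integral_sub => [y|y _|y _].
    - by move=> /le_trans; apply; lra.
    - by rewrite lee_fin g_ge0 lexx.
    - by rewrite lee_fin.
  rewrite lee_fin /a.
  have sd : (ratr s `^ (- (p - n%:R)) <=
      2 `^ (p - n%:R) * sup_norm x `^ (- (p - n%:R)))%R.
    rewrite -(powRN_half _ (ltW x0)); apply: (ler_powRN (ltW d0)).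
      by rewrite divr_gt0.
    exact: ltW.
  rewrite -(powRN_exprn p x0) -/(w x) in sd.
  have D0 : (0 < 2 `^ (p - n%:R) :> R)%R by rewrite powR_gt0.
  have E0 : (0 < 4 ^+ n :> R)%R by rewrite exprn_gt0.
  have c0 : (0 < t / (2 * 4 ^+ n * 2 `^ (p - n%:R)))%R.
    by rewrite divr_gt0// !mulr_gt0.
  apply: (le_trans (ler_wpM2l (ltW c0) sd)).
  have xl : ((sup_norm x / 4) ^+ n <= ratr q.1 ^+ n)%R.
    have xl : (sup_norm x / 4 <= ratr q.1)%R by lra.
    by apply: lerXn2r xl; rewrite nnegrE ltW// divr_gt0.
  have -> : (t / (2 * 4 ^+ n * 2 `^ (p - n%:R)) *
      (2 `^ (p - n%:R) * (w x * sup_norm x ^+ n)) =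
      t * (w x * (sup_norm x / 4) ^+ n) / 2)%R.
    by rewrite expr_div_n; field; rewrite !gt_eqF.
  by rewrite ler_wpM2r// ler_wpM2l ?(ltW t0)// ler_wpM2l// sup_weight_ge0.
apply: Or33.
have aG : (a / 2)%:E <= ((5 * ratr q.1) ^+ n)%:E *
    \int[lebesgueRn]_y (outer_density (x, y))%:E.
  rewrite leNgt; apply/negP => Ga; move: tq; apply/negP; rewrite -leNgt.
  apply: (le_trans FG); rewrite [a]splitr EFinD.
  by apply: leeD; exact: ltW.
have c0 : (0 < (5 * ratr q.1 : R) ^+ n)%R by rewrite exprn_gt0// mulr_gt0.
have dens0 y : [set: Rn R n] y -> 0 <= (outer_density (x, y))%:E.
  by move=> _; rewrite lee_fin outer_density_ge0.
rewrite (ge0_integralZl_EFin lebesgueRn measurableT dens0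
  (measurable_outer_section x) (u_ge0 x)).
rewrite mulrCA EFinM; apply: lee_wpmul2l; first by rewrite lee_fin.
rewrite -(@lee_pmul2l _ ((5 * ratr q.1) ^+ n)%:E)//.
apply: le_trans aG; rewrite -EFinM lee_fin /a le_eqVlt; apply/orP; left.
have c5 : (5 ^+ n != 0 :> R)%R by rewrite expf_neq0.
by apply/eqP; rewrite exprMn; field.
Qed.

(** The constants of the near, inner and outer estimates, the last two
    multiplied by the loss in the level [t] that [near_inner_outer] causes. *)
Definition mixed_constant : R :=
  (2 `^ p * 3 ^+ n +
   8 ^+ n / (1 - 2 `^ (- (p - n%:R))) * (2 * 4 ^+ n * 2 `^ (p - n%:R)) +
   2 * 5 ^+ n * 4 ^+ n)%R.

Lemma mixed_constant_ge0 : (0 <= mixed_constant)%R.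
Proof.
rewrite !addr_ge0// !mulr_ge0 ?powR_ge0 ?exprn_ge0// invr_ge0 subr_ge0 ltW//.
exact: powR2N_lt1.
Qed.

(** The outer part is kept as a function rather than a set: bounding the
    indicator of the outer set by [c / t] times the Hardy operator is
    Chebyshev's inequality. *)
Lemma mixed_estimate (t : R) (D : set (Rn R n)) : (0 < t)%R ->
  (forall x, D x -> (0 < sup_norm x)%R ->
   exists q, [/\ (0 < q.1)%R, rat_cube q x &
     (t * (w x * ratr q.1 ^+ n))%:E <
       \int[lebesgueRn]_(y in rat_cube q) (g y)%:E]) ->
  \int[lebesgueRn]_(x in D) (u x * w x)%:E <=
  (mixed_constant / t)%:E * \int[lebesgueRn]_x ((g x)%:E * M x).
Proof.
move=> t0 bad.
pose c2 : R := (2 * 4 ^+ n * 2 `^ (p - n%:R))%R.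
pose c3 : R := (2 * 5 ^+ n)%R.
pose K1 : R := (2 `^ p * 3 ^+ n)%R.
pose K2 : R := (8 ^+ n / (1 - 2 `^ (- (p - n%:R))))%R.
have c20 : (0 < c2)%R by rewrite !mulr_gt0 ?powR_gt0 ?exprn_gt0.
have c30 : (0 < c3)%R by rewrite mulr_gt0 ?exprn_gt0.
have K10 : (0 <= K1)%R by rewrite mulr_ge0 ?powR_ge0 ?exprn_ge0.
have K20 : (0 <= K2)%R.
  by rewrite divr_ge0 ?exprn_ge0// subr_ge0 ltW// powR2N_lt1.
set I := integral _ setT _.
have I0 : 0 <= I by exact: integral_ge0.
pose E1 : set (Rn R n) := \bigcup_(q in near_cubes t) rat_cube q.
pose E2 : set (Rn R n) :=
  \bigcup_(q in inner_radii (t / c2)) sup_exterior (ratr q).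
pose O x := \int[lebesgueRn]_y outer_kernel (x, y).
have O0 x : 0 <= O x by apply: integral_ge0 => y _; exact: outer_kernel_ge0.
have mO : measurable_fun [set: Rn R n] O := measurable_outer_integral.
have mE1 : measurable E1.
  rewrite /E1 bigcup_mkcond; apply: countable_bigcupT_measurable => // q.
  by case: ifP => // _; exact: measurable_rat_cube.
have mE2 : measurable E2.
  rewrite /E2 bigcup_mkcond; apply: countable_bigcupT_measurable => // q.
  by case: ifP => // _; exact: measurable_sup_exterior.
pose h x := (u x * w x)%:E.
have hE0 (E : set (Rn R n)) x : 0 <= (h \_ E) x.
  by apply: erestrict_ge0 => z _; exact: uw_ge0.
have mhE (E : set (Rn R n)) :
    measurable E -> measurable_fun [set: Rn R n] (h \_ E).
  by move=> mE; apply/(measurable_restrictT _ mE).1; exact: measurable_funTS.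
have c3t : (0 <= c3 / t)%R by rewrite divr_ge0// ltW.
pose O' x := (c3 / t)%:E * O x.
have O'0 x : 0 <= O' x by apply: mule_ge0 => //; rewrite lee_fin.
have mO' : measurable_fun [set: Rn R n] O'.
  by apply: emeasurable_funM mO; exact: measurable_cst.
have m1 := mhE _ mE1; have m2 := mhE _ mE2.
apply: (@le_trans _ _
    (\int[lebesgueRn]_x ((h \_ E1) x + ((h \_ E2) x + O' x)))).
  apply: ge0_le_integral_sub => // x; last by rewrite !adde_ge0.
  move=> Dx; rewrite uw_ge0/=.
  (* at the origin [w] is 0, since [0 `^ (- p)] is 0 *)
  have := sup_norm_ge0 x; rewrite le_eqVlt => /predU1P[x0|x0].
    rewrite /sup_weight -x0 powR0 ?mulr0 ?adde_ge0//.
    by rewrite oppr_eq0 gt_eqF// (le_lt_trans _ np).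
  have [q [q0 qx tq]] := bad x Dx x0.
  have [E1x|E2x|Ox] := near_inner_outer t0 x0 q0 qx tq.
  - by rewrite patchE mem_set// leeDl// adde_ge0.
  - by rewrite addeCA [X in _ <= X + _]patchE mem_set// leeDl// adde_ge0.
  - rewrite addeA addeC; apply: (@le_trans _ _ (O' x)); last first.
      by rewrite leeDl// adde_ge0.
    apply: (@le_trans _ _ ((c3 / t)%:E * (t / c3 * (u x * w x))%:E)).
      rewrite -EFinM lee_fin le_eqVlt; apply/orP; left; apply/eqP.
      by field; rewrite !gt_eqF.
    by apply: lee_wpmul2l => //; rewrite lee_fin.
have S0 x : [set: Rn R n] x -> 0 <= (h \_ E2) x + O' x.
  by move=> _; exact: adde_ge0.
have mS : measurable_fun [set: Rn R n] (fun x => (h \_ E2) x + O' x).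
  exact: (emeasurable_funD m2 mO').
rewrite (ge0_integralD lebesgueRn measurableT (fun x _ => hE0 E1 x) m1 S0 mS).
rewrite (ge0_integralD lebesgueRn measurableT (fun x _ => hE0 E2 x) m2
  (fun x _ => O'0 x) mO').
rewrite -!integral_mkcond.
rewrite (ge0_integralZl_EFin lebesgueRn measurableT (fun x _ => O0 x) mO c3t).
have e1 := near_estimate t0; rewrite -/E1 -/I -/K1 in e1.
have tc2 : (0 < t / c2)%R by rewrite divr_gt0.
have e2 := inner_estimate tc2; rewrite -/E2 -/I -/K2 in e2.
have e3 := outer_estimate; rewrite -/I in e3.
apply: (@le_trans _ _ ((K1 / t)%:E * I + ((K2 / (t / c2))%:E * I +
    (c3 / t)%:E * ((4 ^+ n)%:E * I)))).
  by apply: leeD e1 _; apply: leeD e2 _; apply: lee_wpmul2l e3; rewrite lee_fin.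
have -> : (mixed_constant / t =
    K1 / t + (K2 / (t / c2) + c3 / t * 4 ^+ n))%R.
  rewrite /mixed_constant -/K1 -/K2 -/c2 -/c3.
  by field; rewrite !gt_eqF.
have K1t : (0 <= K1 / t)%R by rewrite divr_ge0// ltW.
have K2t : (0 <= K2 / (t / c2))%R by rewrite divr_ge0// ltW.
have c3n : (0 <= c3 / t * 4 ^+ n)%R by rewrite mulr_ge0// exprn_ge0.
rewrite EFinD ge0_muleDl ?lee_fin ?addr_ge0//.
by rewrite EFinD ge0_muleDl ?lee_fin// EFinM muleA.
Qed.
End mixed_estimates.

(** * The weight of the Euclidean norm *)

Lemma power_weight_le_sup_weight (R : realType) n (r : R) (x : Rn R n) :
  0 <= r -> 0 < sup_norm x -> power_weight r x <= sup_weight (n%:R * r) x.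
Proof.
move=> r0 x0; apply: ler_powRN (sup_norm_le_euclid x) => //.
by rewrite mulr_ge0.
Qed.

(** The Euclidean norm is at most [n] times the sup norm. *)
Lemma sup_weight_le_power_weight (R : realType) n (r : R) (x : Rn R n) :
  (0 < n)%N -> 0 <= r -> 0 < sup_norm x ->
  n%:R `^ (- (n%:R * r)) * sup_weight (n%:R * r) x <= power_weight r x.
Proof.
move=> n0 r0 x0; rewrite /sup_weight -powRM ?sup_norm_ge0//.
apply: ler_powRN (euclid_le_sup_norm x); first by rewrite mulr_ge0.
exact: lt_le_trans x0 (sup_norm_le_euclid x).
Qed.

(** At the origin the weight takes the value 0, which makes the comparison with
    [sup_weight] hold there as well. *)
Lemma power_weight0 (R : realType) n (r : R) (x : Rn R n) :
  (0 < n)%N -> 0 < r -> sup_norm x = 0 -> power_weight r x = 0.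
Proof.
move=> n0 r0 x0; rewrite /power_weight (_ : euclid_norm x = 0).
  by rewrite powR0// oppr_eq0 mulf_neq0 ?pnatr_eq0 ?gt_eqF// -lt0n.
apply/eqP; rewrite eq_le sqrtr_ge0 andbT.
by apply: (le_trans (euclid_le_sup_norm x)); rewrite x0 mulr0.
Qed.

Lemma measurable_euclid_norm (R : realType) n :
  measurable_fun [set: Rn R n] (@euclid_norm R n).
Proof.
have msum : measurable_fun [set: Rn R n]
    (fun x => \sum_(i < n) (tnth x i : R) ^+ 2).
  apply: measurable_sum => i.
  exact: (measurable_funX 2 (@measurable_coord R n i)).
rewrite (_ : euclid_norm = fun x => (\sum_(i < n) (tnth x i : R) ^+ 2) `^ 2^-1).
  exact: (measurableT_comp (measurable_powR _) msum).
apply/funext => x; rewrite powR12_sqrt//.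
by apply: sumr_ge0 => i _; exact: sqr_ge0.
Qed.

Lemma measurable_power_weight (R : realType) n (r : R) :
  measurable_fun [set: Rn R n] (@power_weight R n r).
Proof.
exact: (measurableT_comp (measurable_powR _) (@measurable_euclid_norm R n)).
Qed.

Theorem theorem1p9 (R : realType) (n : nat) (n_gt0 : (0 < n)%N)
    (u : Rn R n -> R) (u_ge0 : forall x, 0 <= u x)
    (u_meas : measurable_fun [set: Rn R n] u) (r : R) (r_gt1 : 1 < r) :
  let v := @power_weight R n r in
  exists C : R, forall t : R, 0 < t ->
    forall f : Rn R n -> R, measurable_fun [set: Rn R n] f ->
    (\int[lebesgueRn]_(x in [set x : Rn R n |
        maximal (fun y => f y * v y)%R x / (v x)%:E > t%:E]) (u x * v x)%:E
     <= (C / t)%:E *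
        \int[lebesgueRn]_x (`|(f x)%:E| * maximal u x * (v x)%:E))%E.
Proof.
move=> v.
have r0 : 0 < r by rewrite (lt_trans ltr01).
have n0 : 0 < n%:R :> R by rewrite ltr0n.
pose p := n%:R * r.
have np : n%:R < p by rewrite /p ltr_pMr.
have v_ge0 x : 0 <= v x by exact: powR_ge0.
(* [n^(-p)] compares the two weights, and [2^(-n)] is the loss in passing to
   rational cubes *)
pose a : R := n%:R `^ (- p) / 2 ^+ n.
have a0 : 0 < a by rewrite divr_gt0 ?powR_gt0 ?exprn_gt0.
exists (@mixed_constant R n p / a) => t t0 f mf.
pose g x : R := `|f x| * v x.
have g0 x : 0 <= g x by rewrite mulr_ge0.
have mg : measurable_fun [set: Rn R n] g.
  apply: measurable_funM; last exact: measurable_power_weight.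
  exact: (measurableT_comp (@normr_measurable R setT) mf).
have at0 : 0 < t * a by rewrite mulr_gt0.
set D := [set x | _].
have bad x : D x -> 0 < sup_norm x -> exists q, [/\ 0 < q.1, rat_cube q x &
    ((t * a * (sup_weight p x * ratr q.1 ^+ n))%:E <
       \int[lebesgueRn]_(y in rat_cube q) (g y)%:E)%E].
  move=> Dx x0.
  have wv : n%:R `^ (- p) * sup_weight p x <= v x.
    by apply: sup_weight_le_power_weight => //; exact: ltW.
  have w0 : 0 < n%:R `^ (- p) * sup_weight p x by rewrite mulr_gt0 ?powR_gt0.
  have vx0 : 0 < v x := lt_le_trans w0 wv.
  have : ((t * (n%:R `^ (- p) * sup_weight p x))%:E <
      maximal (fun y => (f y * v y)%R) x)%E.
    move: Dx; rewrite /D/= inver gt_eqF//.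
    rewrite -(@lte_pmul2r _ (v x)%:E)// -muleA -!EFinM mulVf ?gt_eqF// mule1.
    by apply: le_lt_trans; rewrite lee_fin ler_wpM2l// ltW.
  move=> /(maximal_gt_rat_cube _)[|q [q0 qx tq]].
    by rewrite mulr_ge0// ltW.
  exists q; split => //.
  rewrite (_ : (\int[lebesgueRn]_(y in rat_cube q) (g y)%:E =
      \int[lebesgueRn]_(y in rat_cube q) `|(f y * v y)%:E|)%E); last first.
    apply: eq_integral => y _.
    by rewrite abse_EFin normrM (ger0_norm (v_ge0 y)).
  apply: le_lt_trans tq; rewrite lee_fin /a le_eqVlt.
  by apply/orP; left; apply/eqP; field; rewrite expf_neq0.
apply: (@le_trans _ _ (\int[lebesgueRn]_(x in D) (u x * sup_weight p x)%:E)%E).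
  apply: ge0_le_integral_sub => // x _; last first.
    by rewrite lee_fin mulr_ge0// sup_weight_ge0.
  rewrite !lee_fin mulr_ge0//= ler_wpM2l//.
  have := sup_norm_ge0 x; rewrite le_eqVlt => /predU1P[x0|x0].
    by rewrite /v power_weight0// sup_weight_ge0.
  by apply: power_weight_le_sup_weight => //; exact: ltW.
apply: (le_trans (mixed_estimate u_ge0 u_meas g0 mg np at0 bad)).
have -> : @mixed_constant R n p / a / t = @mixed_constant R n p / (t * a).
  by field; rewrite !gt_eqF.
apply: lee_wpmul2l.
  rewrite lee_fin divr_ge0 ?(ltW at0)//.
  exact: mixed_constant_ge0.
apply: ge0_le_integral_sub => // x _.
  apply/andP; split; first by rewrite mule_ge0 ?lee_fin ?rat_maximal_ge0.
  rewrite /g EFinM -!muleA; apply: lee_wpmul2l; first by rewrite lee_fin.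
  rewrite muleC; apply: lee_wpmul2r; first by rewrite lee_fin.
  exact: rat_maximal_le_maximal.
apply: mule_ge0; last by rewrite lee_fin.
apply: mule_ge0 => //.
exact: le_trans (rat_maximal_ge0 u x) (rat_maximal_le_maximal u x).
Qed.
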